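(* Let $a\in\mathbb Z\cup\{-\infty\}$ and $b=\infty$, and let $f=(f_n\colon n\in\overline{a,\infty})$ and $g=(g_n\colon n\in\overline{a,\infty})$ be real sequences such that $g$ takes no zero value and has constant sign on $\overline{a,\infty}$, and $\Delta g$ takes no zero value and has constant sign on $\overline{a+1,\infty}$. Let $r:=f/g$ on $\overline{a,\infty}$ and $\rho:=\Delta f/\Delta g$ on $\overline{a+1,\infty}$. Suppose that either (i) $\lim_{n\to\infty}|g_n|=\infty$; or (ii) $\lim_{n\to\infty}f_n=\lim_{n\to\infty}g_n=0$. If the limit $\rho_\infty:=\lim_{n\to\infty}\rho_n$ exists in $[-\infty,\infty]$, then the limit $r_\infty:=\lim_{n\to\infty}r_n$ exists and $r_\infty=\rho_\infty$.
   Context: For $a\in\mathbb Z\cup\{-\infty\}$, $\overline{a,\infty}:=\{n\in\mathbb Z\colon n\ge a\}$, with the convention $-\infty+1:=-\infty$. For a sequence $f$ on $\overline{a,\infty}$, $\Delta f$ is the sequence on $\overline{a+1,\infty}$ given by $\Delta f_n:=(\Delta f)_n:=f_n-f_{n-1}$. Quotients of sequences are taken termwise: $r_n=f_n/g_n$, $\rho_n=\Delta f_n/\Delta g_n$. Limits are allowed to be infinite. *)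

(* Defs.v *)
From HB Require Import structures.
From mathcomp Require Import all_boot all_order all_algebra.
From mathcomp Require Import all_classical all_reals all_analysis.

Set Implicit Arguments.
Unset Strict Implicit.
Unset Printing Implicit Defensive.

Import Order.TTheory GRing.Theory Num.Theory.
Import numFieldNormedType.Exports.

Local Open Scope classical_set_scope.
Local Open Scope ring_scope.

(* The left endpoint a ranges over Z extended by -oo; it is an element of
   \bar int other than +oo. The sum (a + 1)%E then satisfies -oo + 1 = -oo. *)
Definition int_ray (a : \bar int) : set int := [set n | (a <= n%:E)%E].

(* A sequence on int_ray a is represented by a total function on int whose
   values off int_ray a are irrelevant. *)
Definition Delta (V : zmodType) (f : int -> V) (n : int) : V := f n - f (n - 1).

Definition nonvanishing_on (V : zmodType) (D : set int) (f : int -> V) : Prop :=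
  forall n, D n -> f n != 0.

Definition constant_sign_on (R : realDomainType) (D : set int) (f : int -> R) :
    Prop :=
  forall m n, D m -> D n -> Num.sg (f m) = Num.sg (f n).

(* The analogue on int of the filter \oo on nat. Every int_ray a with a != +oo
   belongs to it, so limits along it ignore the values off the ray. *)
Definition int_infty : set_system int :=
  filter_from setT (fun N : int => [set n | N <= n]).

Global Instance int_infty_filter : ProperFilter int_infty.
Proof.
apply: filter_from_proper => [|N _]; last by exists N => /=.
apply: filter_from_filter; first by exists 0.
move=> i j _ _; exists (Num.max i j) => // n /=.
by rewrite ge_max => /andP[].
Qed.

(* Main.v *)
(* Replacing (f, g) by (-f, -g) we may assume that Delta g is eventually
   positive. If Delta f / Delta g <= c eventually, then f - c g is eventually
   nonincreasing. When |g| tends to infinity, g tends to +oo and f - c g is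
   bounded above, so f / g is eventually below any c' > c. When f and g tend
   to 0, f - c g decreases to 0 while g increases to 0, so f - c g >= 0 > g and
   f / g <= c. Lower bounds follow by applying this to -f. *)

Require Import Defs.
From HB Require Import structures.
From mathcomp Require Import all_boot all_order all_algebra.
From mathcomp Require Import all_classical all_reals all_analysis.
From mathcomp Require Import lra.
Import Order.TTheory GRing.Theory Num.Theory.
Import numFieldNormedType.Exports.

Local Open Scope classical_set_scope.
Local Open Scope ring_scope.

Lemma near_int_inftyP (P : int -> Prop) :
  (\forall n \near int_infty, P n) <-> exists N, forall n, N <= n -> P n.
Proof.
split=> [[N _ NP]|[N NP]]; first by exists N => n Nn; exact: NP.
by exists N.
Qed.

Lemma near_int_infty_ge (N : int) : \forall n \near int_infty, N <= n.
Proof. by exists N. Qed.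

Lemma Delta_ge0_nondecreasing (R : numDomainType) (h : int -> R) (N : int) :
  (forall n : int, N <= n -> 0 <= Delta h n) ->
  forall m n : int, N <= m -> m <= n -> h m <= h n.
Proof.
move=> h0 m n Nm mn.
have -> : n = m + `|n - m|%N%:Z by rewrite gez0_abs ?subr_ge0// subrKC.
elim: `|n - m|%N => [|k IH]; first by rewrite addr0.
have := h0 (m + k.+1%:Z); rewrite /Delta -addrA -predn_int// subr_ge0.
by rewrite ler_wpDr// => /(_ isT); exact: le_trans IH.
Qed.

(** From [n] on, all values are at least [h n] by monotonicity, and the limit inherits this bound.
    It serves both [g] and [c * g - f] when [f] and [g] tend to 0. *)
Lemma Delta_ge0_le_cvg (R : realFieldType) (h : int -> R) (N : int) (x : R) :
  (forall n : int, N <= n -> 0 <= Delta h n) -> h n @[n --> int_infty] --> x ->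
  forall n : int, N <= n -> h n <= x.
Proof.
move=> h0 hx n Nn.
rewrite -(cvg_lim (@Rhausdorff _) hx); apply: limr_ge; first exact: cvgP hx.
apply/near_int_inftyP; exists n => m.
exact: Delta_ge0_nondecreasing h0 _ _ Nn.
Qed.

(** Allows finite and infinite limits to be handled together: a finite [l] uses the bounds at
    [l + e] and [l - e], [+oo] only the lower bounds, [-oo] only the upper ones. *)
Lemma ereal_cvg_real_bounds (R : realFieldType) (T : Type) (F : set_system T)
    (FF : Filter F) (u : T -> R) (l : \bar R) :
  (forall c, (l < c%:E)%E -> \forall x \near F, u x <= c) ->
  (forall c, (c%:E < l)%E -> \forall x \near F, c <= u x) ->
  (u x)%:E @[x --> F] --> l.
Proof.
case: l => [l| |] ub lb.
- apply: cvg_EFin; first exact: nearW.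
  apply/cvgrPdist_le => e e0.
  have := ub (l + e); rewrite lte_fin ltrDl => /(_ e0) ule.
  have := lb (l - e); rewrite lte_fin ltrBlDr ltrDl => /(_ e0) leu.
  near=> x; rewrite ler_distlC; apply/andP; split; first by near: x.
  by near: x.
- by apply/cvgeyPge => A; under eq_near do rewrite lee_fin; exact/lb/ltry.
- by apply/cvgeNyPle => A; under eq_near do rewrite lee_fin; exact/ub/ltNyr.
Unshelve. all: by end_near. Qed.

Lemma ereal_cvg_eventually_le (R : realFieldType) (T : Type)
    (F : set_system T) (FF : Filter F) (u : T -> R) (l : \bar R) (c : R) :
  (u x)%:E @[x --> F] --> l -> (l < c%:E)%E -> \forall x \near F, u x <= c.
Proof.
move=> ul lc.
have nc : nbhs l [set y | (y < c%:E)%E] by exact: open_ereal_lt_ereal lc.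
by near=> x; rewrite -lee_fin ltW//; near: x; exact: ul nc.
Unshelve. all: by end_near. Qed.

Lemma quotient_le_of_Delta_quotient_le (R : realType) (f g : int -> R)
    (c c' : R) :
  (\forall n \near int_infty, 0 < Delta g n) ->
  (`|g n|)%:E @[n --> int_infty] --> (+oo%E : \bar R) \/
    f n @[n --> int_infty] --> (0 : R) /\
    g n @[n --> int_infty] --> (0 : R) ->
  (\forall n \near int_infty, Delta f n / Delta g n <= c) -> c < c' ->
  \forall n \near int_infty, f n / g n <= c'.
Proof.
move=> Dg0 hlim rho_le cc'.
have [N DN] : exists N, forall n : int, N <= n ->
    0 < Delta g n /\ Delta f n / Delta g n <= c.
  by apply/near_int_inftyP; near=> n; split; near: n.
have Dg_ge0 (n : int) : N <= n -> 0 <= Delta g n by move=> /DN[/ltW].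
(* The sign is chosen so that [h] is nondecreasing: [Delta h n = c * Delta g n - Delta f n]. *)
pose h n := c * g n - f n.
have Dh_ge0 (n : int) : N <= n -> 0 <= Delta h n.
  by move=> /DN[Dgn]; rewrite ler_pdivrMr// /Delta /h; lra.
case: hlim => [goo|[f0 g0]]; last first.
- have h0 : h n @[n --> int_infty] --> (0 : R).
    rewrite -[0 in X in _ --> X](subrr (c * 0)) [in X in _ - X]mulr0.
    by apply: cvgB => //; exact: cvgMr.
  near=> n; have Nn : N <= n by near: n; exact: near_int_infty_ge.
  have := Delta_ge0_le_cvg _ _ _ _ Dh_ge0 h0 _ Nn.
  have : g n < 0.
    (* Monotone convergence gives only [g (n + 1) <= 0]; the strict increase from [n] to [n + 1]
       makes [g n] negative. *)
    have N1 : N <= n + 1 by rewrite ler_wpDr.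
    apply: lt_le_trans (Delta_ge0_le_cvg _ _ _ _ Dg_ge0 g0 _ N1).
    by have [+ _] := DN _ N1; rewrite /Delta addrK subr_gt0.
  (* From [h n <= 0] and [g n < 0] follows [f n >= c * g n >= c' * g n]; dividing by [g n] reverses
     the inequality. *)
  by move=> gn0; rewrite ler_ndivrMr// /h; nra.
- have g_ge (A : R) : \forall n \near int_infty, A <= `|g n|.
    by move/cvgeyPge : goo => /(_ A); apply: filterS => n; rewrite lee_fin.
  near=> n; have Nn : N <= n by near: n; exact: near_int_infty_ge.
  have gN := Delta_ge0_nondecreasing _ _ _ Dg_ge0 _ _ (lexx N) Nn.
  have hN := Delta_ge0_nondecreasing _ _ _ Dh_ge0 _ _ (lexx N) Nn.
  (* This threshold rules out [g n <= 0]: then [g N <= g n <= 0] would give [|g n| <= |g N|]. *)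
  have g_gt : `|g N| + 1 <= `|g n| by near: n; exact: g_ge.
  (* Since [h N <= h n], [f n <= c * g n - h N]; this threshold makes [- h N] at most
     [(c' - c) * g n]. *)
  have : - h N / (c' - c) <= `|g n| by near: n; exact: g_ge.
  have gn0 : 0 < g n.
    rewrite ltNge; apply/negP => gn0.
    move: g_gt; rewrite (ler0_norm gn0).
    by have := ler_norm (- g N); rewrite normrN; lra.
  rewrite gtr0_norm// ler_pdivrMr ?subr_gt0//.
  by rewrite ler_pdivrMr//; move: hN; rewrite {2}/h; lra.
Unshelve. all: by end_near. Qed.

Lemma stolz_cesaro_Delta_gt0 (R : realType) (f g : int -> R) (l : \bar R) :
  (\forall n \near int_infty, 0 < Delta g n) ->
  (`|g n|)%:E @[n --> int_infty] --> (+oo%E : \bar R) \/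
    f n @[n --> int_infty] --> (0 : R) /\
    g n @[n --> int_infty] --> (0 : R) ->
  (Delta f n / Delta g n)%:E @[n --> int_infty] --> l ->
  (f n / g n)%:E @[n --> int_infty] --> l.
Proof.
move=> Dg0 hlim hrho.
(* The numerator [k] is kept general, to be taken as [f] for upper bounds and as [-f] for lower
   ones. *)
have le_lim (k : int -> R) (x : \bar R) (c : R) :
    (`|g n|)%:E @[n --> int_infty] --> (+oo%E : \bar R) \/
      k n @[n --> int_infty] --> (0 : R) /\
      g n @[n --> int_infty] --> (0 : R) ->
    (Delta k n / Delta g n)%:E @[n --> int_infty] --> x -> (x < c%:E)%E ->
    \forall n \near int_infty, k n / g n <= c.
  move=> klim kx xc.
  (* A real [d] strictly between [x] and [c] leaves room for both the passage from the limit to an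
     eventual bound and the loss in the one-sided estimate. *)
  have [d xd dc] : exists2 d : R, (x < d%:E)%E & d < c.
    case: x xc {kx} => [x| |] //=; rewrite ?lte_fin => xc.
    - by exists ((x + c) / 2); rewrite ?lte_fin midf_lt.
    - by exists (c - 1); rewrite ?ltNyr// ltrBlDr ltrDl.
  apply: quotient_le_of_Delta_quotient_le dc => //.
  exact: ereal_cvg_eventually_le kx xd.
apply: ereal_cvg_real_bounds => c lc; first exact: le_lim hrho lc.
have := le_lim (fun n => - f n) (- l)%E (- c).
under eq_near do rewrite mulNr lerN2; apply.
- case: hlim => [|[f0 g0]]; [by left|right; split=> //].
  by rewrite -[0]oppr0; exact: cvgN.
- have -> : (fun n => (Delta (fun n => - f n) n / Delta g n)%:E) =
            (fun n => - (Delta f n / Delta g n)%:E)%E.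
    by apply/funext => n; rewrite -EFinN -mulNr /Delta opprD.
  exact: cvgeN.
- by rewrite EFinN lteN2.
Qed.

Theorem proposition2 (R : realType) (a : \bar int) (f g : int -> R)
    (ha : a != +oo%E)
    (hg0 : nonvanishing_on (int_ray a) g)
    (hgs : constant_sign_on (int_ray a) g)
    (hDg0 : nonvanishing_on (int_ray (a + 1)%E) (Delta g))
    (hDgs : constant_sign_on (int_ray (a + 1)%E) (Delta g))
    (hlim : ((`|g n|)%:E @[n --> int_infty] --> (+oo%E : \bar R)) \/
            ((f n @[n --> int_infty] --> (0 : R)) /\
             (g n @[n --> int_infty] --> (0 : R))))
    (rho_oo : \bar R)
    (hrho : (Delta f n / Delta g n)%:E @[n --> int_infty] --> rho_oo) :
  (f n / g n)%:E @[n --> int_infty] --> rho_oo.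
Proof.
(* For [a = -oo] the ray of [a + 1] is all of [int], so any [N] would do. *)
have [N rayN] : exists N, forall n, N <= n -> int_ray (a + 1)%E n.
  case: a ha {hg0 hgs hDg0 hDgs} => [a _|//|_].
  - by exists (a + 1) => n; rewrite /int_ray /= lee_fin.
  - by exists 0 => n _; rewrite /int_ray /= leNye.
have sgN n : N <= n -> Num.sg (Delta g n) = Num.sg (Delta g N).
  by move=> Nn; apply: hDgs; exact: rayN.
have /(_ N (rayN _ (lexx N))) := hDg0.
(* By [sgN], the sign of [Delta g N] is that of [Delta g n] for all [n >= N]. If negative, both
   sequences are negated, which changes neither quotient. *)
rewrite neq_lt => /orP[DgN|DgN].
- have DN (k : int -> R) n : Delta (fun n => - k n) n = - Delta k n.
    by rewrite /Delta opprD.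
  have -> : (fun n => (f n / g n)%:E) = (fun n => (- f n / - g n)%:E).
    by apply/funext => n; rewrite invrN mulrNN.
  apply: stolz_cesaro_Delta_gt0.
  + apply/near_int_inftyP; exists N => n Nn.
    by rewrite DN oppr_gt0 -sgr_lt0 sgN// sgr_lt0.
  + case: hlim => [goo|[f0 g0]]; [left|right].
      by under eq_fun do rewrite normrN.
    by split; rewrite -[0]oppr0; exact: cvgN.
  + by under eq_fun do rewrite !DN invrN mulrNN.
- apply: stolz_cesaro_Delta_gt0 => //; apply/near_int_inftyP; exists N => n Nn.
  by rewrite -sgr_gt0 sgN// sgr_gt0.
Qed.
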